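(* Let $g\ge 4$ and $t\ge 0$ be integers, let $n=g+t(g-2)$, and let $F_n$ be an $n$-cycle. Then $F_n$ is potentially $g$-angulable in $K_n$ if and only if $n\ge 5$.
   Context: $K_n$ denotes the convex complete graph on $n$ points in convex position in the plane, with straight-line edges. A $g$-angulation of the point set is a plane (non-crossing straight-line) graph on the $n$ points in which every face interior to the convex hull is bounded by a $g$-cycle (so it contains all edges of the convex hull boundary). A geometric graph $G$ on these points admits a $g$-angulation if some $g$-angulation has its edge set contained in $E(G)$. A graph $F$ with $n$ vertices is potentially $g$-angulable in $K_n$ if there is a placement of $F$ in $K_n$ (a bijection from $V(F)$ to the $n$ points, edges drawn as straight segments) such that $K_n-F$, obtained by deleting the edges of the placed copy of $F$ from $K_n$, admits a $g$-angulation. *)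

(* Defs.v *)
From mathcomp Require Import all_boot all_order all_algebra.
From mathcomp Require Import all_classical all_reals all_analysis.
Import numFieldNormedType.Exports.

Set Implicit Arguments.
Unset Strict Implicit.
Unset Printing Implicit Defensive.

Local Open Scope classical_set_scope.
Local Open Scope ring_scope.

Section Plane.
Variable R : realType.
Implicit Types (A : set 'rV[R]_2) (a b : 'rV[R]_2).

Definition segment a b : set 'rV[R]_2 :=
  [set (1 - s) *: a + s *: b | s in `[0, 1]%classic].

Definition convex_hull A : set 'rV[R]_2 :=
  smallest [set C | convex_set C] A.

Definition boundary A : set 'rV[R]_2 := closure A `\` interior A.

(* No point lies in the convex hull of the others; in particular p is
   injective. *)
Definition convex_position (n : nat) (p : 'I_n -> 'rV[R]_2) : Prop :=
  forall i, ~ convex_hull (p @` [set j | j != i]) (p i).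

End Plane.

Definition simple_graph (V : finType) (e : rel V) : Prop :=
  symmetric e /\ irreflexive e.

Definition cycle_graph (n : nat) (V : finType) (e : rel V) : Prop :=
  exists c : seq V,
    [/\ (2 < n)%N, size c = n, uniq c, (forall x, x \in c) &
        forall x y, e x y = (next c x == y) || (next c y == x)].

Section GeometricGraphs.
Variables (R : realType) (n : nat) (p : 'I_n -> 'rV[R]_2).
Implicit Types (e G : rel 'I_n) (A : set 'rV[R]_2).

(* A relation e on 'I_n stands for the geometric graph with vertices p i and
   edges drawn as the straight segments between p i and p j for e i j. *)
Definition drawing e : set 'rV[R]_2 :=
  range p `|`
  \bigcup_(ij in [set ij | e ij.1 ij.2]) segment (p ij.1) (p ij.2).

(* Distinct edges meet at most in common endpoints. *)
Definition noncrossing e : Prop :=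
  forall i j k l, e i j -> e k l -> [set i; j] <> [set k; l] ->
  segment (p i) (p j) `&` segment (p k) (p l) `<=`
    p @` ([set i; j] `&` [set k; l]).

(* Faces are taken in the whole plane, so the unbounded face is included. *)
Definition face e A : Prop :=
  exists2 x, (~` drawing e) x & A = connected_component (~` drawing e) x.

Definition bounded_by_cycle (g : nat) e A : Prop :=
  exists c : seq 'I_n,
    [/\ size c = g, ucycle e c &
        boundary A = \bigcup_(v in [set` c]) segment (p v) (p (next c v))].

Definition contains_hull_edges e : Prop :=
  forall i j, i != j ->
  segment (p i) (p j) `<=` boundary (convex_hull (range p)) -> e i j.

(* Without the third clause a graph missing a hull edge could have too few
   faces inside the hull, or none at all, and qualify vacuously. *)
Definition angulation (g : nat) e : Prop :=
  [/\ simple_graph e, noncrossing e, contains_hull_edges e &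
      forall A, face e A -> A `<=` interior (convex_hull (range p)) ->
        bounded_by_cycle g e A].

Definition admits_angulation (g : nat) G : Prop :=
  exists2 e, angulation g e & subrel e G.

(* K_n - F for the placement f of the graph F. *)
Definition complete_minus (V : finType) (F : rel V) (f : V -> 'I_n) :
    rel 'I_n :=
  [rel i j | (i != j) && ~~ [exists u, exists v,
                               [&& F u v, f u == i & f v == j]]].

Definition potentially_angulable (g : nat) (V : finType) (F : rel V) : Prop :=
  exists2 f : V -> 'I_n,
    bijective f & admits_angulation g (complete_minus F f).

End GeometricGraphs.

(* Main.v *)
Require Import Defs.
From mathcomp Require Import all_boot all_order all_algebra.
From mathcomp Require Import all_classical all_reals all_analysis.
From mathcomp Require Import zify ring lra.
Import numFieldNormedType.Exports.
Import Order.TTheory GRing.Theory Num.Theory.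

(** Once a 4-cycle is removed from the complete graph on 4 points, each vertex has a
   single neighbour left, while it lies on two hull edges, which every angulation
   contains; hence [n = 4] is impossible.

   For [n >= 5] put [G = g - 2], so that [n = (t + 1) * G + 2]. The points can be
   numbered so that all triples [i < j < k] are positively oriented
   ([convex_position_ccw_from]): sort them by angle around one of them. Join vertex
   0 to the vertices [1, G + 1, 2 * G + 1, ..., n - 1]. Together with the sides
   these spokes cut the convex polygon into a fan of [t + 1] polygons with [g]
   vertices each. Since [G >= 2], the vertices 2 and [n - 2] are not on a spoke,
   and they differ when [n >= 5]; so a Hamiltonian cycle avoiding the fan exists as
   soon as vertices [1, ..., n - 1] carry a path from 2 to [n - 2] that never
   steps between consecutive numbers. The order [zigzag] is such a path,
   and the given cycle is placed along it.

   That the fan is an angulation comes down to orientation signs. Two chords that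
   do not interleave meet only at common ends, because the ends of one lie on one
   closed side of the other ([fan_noncrossing]). A diagonal passes through the
   interior of the hull, so the hull edges are sides ([diagonal_not_boundary]). For
   faces, the strict side inequalities of a positively oriented polygon define an
   open convex set whose boundary is the union of the sides
   ([boundary_open_polygon]). For a polygon of the fan this open set misses the
   drawing ([fan_segment_disjoint]) while its boundary is part of the drawing, so it
   is a whole face ([connected_component_open]); and every point of the hull lies in
   one of the closed polygons of the fan ([closed_polygon_fan]), so there is no
   other face inside the hull. *)

Set Implicit Arguments.
Unset Strict Implicit.
Unset Printing Implicit Defensive.

Local Open Scope classical_set_scope.
Local Open Scope ring_scope.

(** * Orientation and convex sets in the plane *)

Section Orientation.
Variable R : realType.
Implicit Types (a b c x y : 'rV[R]_2) (s : R) (C : set 'rV[R]_2).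

Definition orient a b c : R :=
  (b 0 0 - a 0 0) * (c 0 1 - a 0 1) - (b 0 1 - a 0 1) * (c 0 0 - a 0 0).

Lemma plane_eqP x y : x 0 0 = y 0 0 -> x 0 1 = y 0 1 -> x = y.
Proof.
move=> e0 e1; apply/rowP => i.
have [->|->] : i = 0 \/ i = 1; last by [].
- by case: i => [[|[|//]] hi]; [left|right]; apply/val_inj.
- by [].
Qed.

Lemma orient_cyc a b c : orient a b c = orient b c a.
Proof. by rewrite /orient; ring. Qed.

Lemma orient_swap a b c : orient b a c = - orient a b c.
Proof. by rewrite /orient; ring. Qed.

Lemma orient_flip a b c : orient a c b = - orient a b c.
Proof. by rewrite /orient; ring. Qed.

Lemma orientl a b : orient a b a = 0.
Proof. by rewrite /orient; ring. Qed.

Lemma orientr a b : orient a b b = 0.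
Proof. by rewrite /orient; ring. Qed.

Lemma orient_affine a b x y s :
  orient a b ((1 - s) *: x + s *: y) = (1 - s) * orient a b x + s * orient a b y.
Proof. by rewrite /orient !mxE; ring. Qed.

Lemma orient0_line a b x : a != b -> orient a b x = 0 ->
  exists s, x = (1 - s) *: a + s *: b.
Proof.
move=> ab; rewrite /orient => o0.
have [e0|n0] := eqVneq (b 0 0) (a 0 0).
  have n1 : b 0 1 - a 0 1 != 0.
    by apply: contra_neq ab => e1; apply: plane_eqP => //; lra.
  exists ((x 0 1 - a 0 1) / (b 0 1 - a 0 1)).
  move: o0; rewrite e0 subrr mul0r sub0r => /eqP.
  rewrite oppr_eq0 mulf_eq0 (negPf n1) /= => /eqP x0.
  by apply: plane_eqP; rewrite !mxE ?e0; [lra|field].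
have n1 : b 0 0 - a 0 0 != 0 by rewrite subr_eq0.
exists ((x 0 0 - a 0 0) / (b 0 0 - a 0 0)).
have e1 : x 0 1 = a 0 1 + (b 0 1 - a 0 1) * (x 0 0 - a 0 0) / (b 0 0 - a 0 0).
  have -> : (b 0 1 - a 0 1) * (x 0 0 - a 0 0) =
            (b 0 0 - a 0 0) * (x 0 1 - a 0 1) by lra.
  by rewrite mulrAC divff// mul1r; ring.
by apply: plane_eqP; rewrite !mxE ?e1; field.
Qed.

(** Convexity with a bare real parameter instead of a bundled element of [0, 1]. *)
Definition segment_closed C := forall x y s, 0 <= s -> s <= 1 -> C x -> C y ->
  C ((1 - s) *: x + s *: y).

Lemma convex_setP C : convex_set C <-> segment_closed C.
Proof.
split=> [cC x y s s0 s1 Cx Cy|cC x y l xC yC].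
  have := cC y x (Itv01 s0 s1).
  by rewrite !inE /= => /(_ Cy Cx); rewrite /conv /= addrC.
rewrite inE in xC; rewrite inE in yC; rewrite inE /conv /= addrC.
by apply: cC.
Qed.

(** The three orientations are, up to the factor [orient a b c], the barycentric
   coordinates of [x]. *)
Lemma segment_closed_triangle C a b c x : segment_closed C ->
  C a -> C b -> C c -> 0 < orient a b c ->
  0 <= orient a b x -> 0 <= orient b c x -> 0 <= orient c a x -> C x.
Proof.
move=> cC Ca Cb Cc D0 w0 u0 v0.
set D := orient a b c in D0.
have DE : orient a b x + orient b c x + orient c a x = D.
  by rewrite /D /orient; ring.
set u := orient b c x in u0 DE; set v := orient c a x in v0 DE.
set w := orient a b x in w0 DE.
have Dn : D != 0 by rewrite gt_eqF.
have xE : x = (u / D) *: a + (v / D) *: b + (w / D) *: c.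
  apply: plane_eqP; rewrite !mxE; apply: (mulfI Dn).
    have -> : D * (u / D * a 0 0 + v / D * b 0 0 + w / D * c 0 0) =
      u * a 0 0 + v * b 0 0 + w * c 0 0 by field.
    by rewrite -DE /u /v /w /orient; ring.
  have -> : D * (u / D * a 0 1 + v / D * b 0 1 + w / D * c 0 1) =
    u * a 0 1 + v * b 0 1 + w * c 0 1 by field.
  by rewrite -DE /u /v /w /orient; ring.
have [uv0|uv0] := eqVneq (u + v) 0.
  have [u_0 v_0 w_D] : [/\ u = 0, v = 0 & w = D] by split; lra.
  by rewrite xE u_0 v_0 w_D !mul0r !scale0r !add0r divff// scale1r.
have uvp : 0 < u + v by rewrite lt_def uv0 addr_ge0.
have -> : x = (1 - w / D) *: ((1 - v / (u + v)) *: a + (v / (u + v)) *: b)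
             + (w / D) *: c.
  rewrite xE scalerDr !scalerA; congr (_ *: _ + _ *: _ + _); rewrite -DE; field.
    by rewrite uv0 /=; apply: contra_neq Dn => ?; lra.
  by rewrite uv0 /=; apply: contra_neq Dn => ?; lra.
apply: (cC) => //.
- by rewrite divr_ge0// ltW.
- by rewrite ler_pdivrMr// mul1r; lra.
- apply: cC => //.
    by rewrite divr_ge0// ltW.
  by rewrite ler_pdivrMr// mul1r; lra.
Qed.

Lemma hull_closed (A : set 'rV[R]_2) : segment_closed (convex_hull A).
Proof.
move=> x y s s0 s1 hx hy C [cC AC].
by move/convex_setP: (cC); apply => //; [apply: hx|apply: hy].
Qed.

Lemma sub_hull (A : set 'rV[R]_2) : A `<=` convex_hull A.
Proof. exact: sub_gen_smallest. Qed.

Lemma hull_min (A C : set 'rV[R]_2) : segment_closed C -> A `<=` C ->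
  convex_hull A `<=` C.
Proof. by move=> /convex_setP cC AC; apply: smallest_sub. Qed.

Lemma halfplane_closed a b : segment_closed [set x | 0 <= orient a b x].
Proof.
move=> x y s s0 s1 /= hx hy; rewrite orient_affine.
by rewrite addr_ge0// mulr_ge0// subr_ge0.
Qed.

Lemma segmentP a b x : segment a b x <->
  exists s, [/\ 0 <= s, s <= 1 & x = (1 - s) *: a + s *: b].
Proof.
split; rewrite /segment /=.
  by case=> s /=; rewrite in_itv /= => /andP[s0 s1] <-; exists s.
by case=> s [s0 s1 ->]; exists s => //=; rewrite in_itv /= s0 s1.
Qed.

Lemma segment_sub C a b : segment_closed C -> C a -> C b -> segment a b `<=` C.
Proof. by move=> cC Ca Cb x /segmentP[s [s0 s1 ->]]; apply: cC. Qed.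

Lemma segmentC a b : segment a b = segment b a.
Proof.
by apply/seteqP; split=> x /segmentP[s [s0 s1 ->]]; apply/segmentP;
  exists (1 - s); split; [lra|lra|rewrite addrC subKr|lra|lra|rewrite addrC subKr].
Qed.

Lemma segmentl a b : segment a b a.
Proof. by apply/segmentP; exists 0; rewrite subr0 scale1r scale0r addr0. Qed.

Lemma segmentr a b : segment a b b.
Proof. by rewrite segmentC; apply: segmentl. Qed.

(** The cases are those of the affine parameter of [c] on the line [ab], compared
   with 0 and 1. *)
Lemma collinear_between a b c : a != b -> orient a b c = 0 ->
  [\/ segment a b c, segment a c b | segment b c a].
Proof.
move=> ab /(orient0_line ab)[s cE].
have [s0|s0] := ltP s 0.
  apply: Or33; apply/segmentP; exists (1 / (1 - s)).
  have p : 0 < 1 - s by lra.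
  have q : 1 - s != 0 by rewrite gt_eqF.
  split; first by rewrite divr_ge0// ltW.
    by rewrite ler_pdivrMr//; lra.
  by rewrite cE; apply: plane_eqP; rewrite !mxE; field.
have [s1|s1] := leP s 1; first by apply: Or31; apply/segmentP; exists s.
apply: Or32; apply/segmentP; exists (1 / s).
have p : 0 < s by lra.
have q : s != 0 by rewrite gt_eqF.
split; first by rewrite divr_ge0// ltW.
  by rewrite ler_pdivrMr//; lra.
by rewrite cE; apply: plane_eqP; rewrite !mxE; field.
Qed.

End Orientation.

(** * Cyclic order of points in convex position *)

(** The vertices of a convex polygon in counterclockwise order. They are indexed by
   [nat] so that subpolygons are obtained by composing with a function. *)
Definition ccw (R : realType) (m : nat) (q : nat -> 'rV[R]_2) : Prop :=
  forall i j k, (i < j)%N -> (j < k)%N -> (k < m)%N ->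
  0 < orient (q i) (q j) (q k).

Section CyclicOrder.
Variables (R : realType) (n : nat) (p : 'I_n -> 'rV[R]_2).
Hypothesis hp : convex_position p.

Lemma in_others_hull i j : j != i -> convex_hull (p @` [set k | k != i]) (p j).
Proof. by move=> ji; apply: sub_hull; exists j. Qed.

Lemma convex_position_inj i j : i != j -> p i != p j.
Proof.
move=> ij; apply/eqP => pij; apply: (hp (i := i)).
by rewrite pij; apply: in_others_hull; rewrite eq_sym.
Qed.

Lemma convex_position_triangle i j k l : l != i -> l != j -> l != k ->
  0 < orient (p i) (p j) (p k) -> 0 <= orient (p i) (p j) (p l) ->
  0 <= orient (p j) (p k) (p l) -> 0 <= orient (p k) (p i) (p l) -> False.
Proof.
move=> li lj lk D0 w0 u0 v0; apply: (hp (i := l)).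
apply: (segment_closed_triangle _ _ _ _ D0 w0 u0 v0); first exact: hull_closed.
- by apply: in_others_hull; rewrite eq_sym.
- by apply: in_others_hull; rewrite eq_sym.
- by apply: in_others_hull; rewrite eq_sym.
Qed.

(** Of three collinear points, one lies on the segment joining the other two, hence
   in the hull of the remaining points. *)
Lemma convex_position_orient_neq0 i j k : i != j -> j != k -> i != k ->
  orient (p i) (p j) (p k) != 0.
Proof.
move=> ij jk ik; apply/eqP => /(collinear_between (convex_position_inj ij)).
have N a b c : a != b -> a != c -> ~ segment (p b) (p c) (p a).
  move=> ab ac S; apply: (hp (i := a)); apply: segment_sub S.
  - exact: hull_closed.
  - by apply: in_others_hull; rewrite eq_sym.
  - by apply: in_others_hull; rewrite eq_sym.
by case; apply: N; rewrite // eq_sym.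
Qed.

Section Around.
Variable a : 'I_n.

Let before : rel 'I_n := [rel i j | (i == j) || (0 < orient (p a) (p i) (p j))].

Let before_total : {in predC1 a &, total before}.
Proof.
move=> i j /=; rewrite !inE => ia ja; rewrite /before /=.
have [//|ij] := eqVneq i j.
have := @convex_position_orient_neq0 a i j.
rewrite ij eq_sym ia eq_sym ja => /(_ isT isT isT).
rewrite /= (orient_flip _ (p i)) oppr_gt0.
by case: ltgtP.
Qed.

(** If [i], [j], [k] went all the way around [a], then [a] would lie in the
   triangle [ijk]. *)
Let before_trans : {in predC1 a & &, transitive before}.
Proof.
move=> j i k /=; rewrite !inE => ja ia ka; rewrite /before /=.
case/orP=> [/eqP->//|aij]; case/orP=> [/eqP<-|ajk]; first by rewrite aij orbT.
have [//|ik /=] := eqVneq i k.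
rewrite ltNge; apply/negP => aik.
have aki : 0 <= orient (p a) (p k) (p i).
  by rewrite orient_flip oppr_ge0.
apply: (@convex_position_triangle i j k a); rewrite 1?eq_sym//.
- have -> : orient (p i) (p j) (p k) = orient (p a) (p i) (p j) +
    orient (p a) (p j) (p k) + orient (p a) (p k) (p i) by rewrite /orient; ring.
  by rewrite ltr_wpDr// addr_gt0.
- by rewrite -orient_cyc ltW.
- by rewrite -orient_cyc ltW.
- by rewrite -orient_cyc.
Qed.

(** Sort the other points by angle as seen from [a]; a triple not containing [a]
   is then positively oriented, for otherwise its middle point would lie in the
   triangle formed by [a] and the two others. *)
Lemma convex_position_ccw_from : exists s : seq 'I_n,
  [/\ uniq s, size s = n & ccw n (fun i => p (nth a s i))].
Proof.
pose r := sort before (rem a (enum 'I_n)).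
have ru : uniq r by rewrite sort_uniq rem_uniq// enum_uniq.
have rE i : (i \in r) = (i != a).
  by rewrite mem_sort mem_rem_uniq ?enum_uniq// !inE mem_enum andbT.
have ar : a \notin r by rewrite rE eqxx.
have sr : (size r).+1 = n.
  have n0 : (0 < n)%N by case: (a) => k; lia.
  by rewrite size_sort size_rem ?mem_enum// size_enum_ord prednK.
have pr : pairwise before r.
  rewrite -(sorted_pairwise_in before_trans).
    apply: (sort_sorted_in before_total).
    by apply/allP => i; rewrite mem_rem_uniq ?enum_uniq// => /andP[].
  by apply/allP => i; rewrite rE.
have nr i : (i < size r)%N -> nth a r i != a by move=> ?; rewrite -rE mem_nth.
have or i j : (i < j)%N -> (j < size r)%N ->
    0 < orient (p a) (p (nth a r i)) (p (nth a r j)).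
  move=> ij js; have is_ := ltn_trans ij js.
  move/pairwiseP: pr => /(_ a i j); rewrite !inE => /(_ is_ js ij) /orP[|//].
  by rewrite nth_uniq// (ltn_eqF ij).
exists (a :: r); split => //=; first by rewrite ar.
move=> [|i] [|j] [|k] //=; rewrite !ltnS => ij jk; rewrite -[X in (_ < X)%N -> _]sr ltnS => kn.
  exact: or.
have js : (j < size r)%N by lia.
have is_ : (i < size r)%N by lia.
have aij := or _ _ ij js; have ajk := or _ _ jk kn.
have aik := or _ _ (ltn_trans ij jk) kn.
rewrite ltNge; apply/negP => ijk.
apply: (@convex_position_triangle a (nth a r i) (nth a r k) (nth a r j)) => //.
- exact: nr.
- by rewrite nth_uniq//; lia.
- by rewrite nth_uniq//; lia.
- exact: ltW.
- by rewrite orient_flip oppr_ge0.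
- by rewrite orient_cyc ltW.
Qed.

End Around.
End CyclicOrder.

(** * Topology of segments and open convex sets *)

Section PlaneTopology.
Variable R : realType.
Implicit Types (a b c x y : 'rV[R]_2) (s : R) (A B C U W : set 'rV[R]_2).

Lemma orient_continuous a b : continuous (orient a b : 'rV[R]_2 -> R).
Proof.
move=> x; rewrite /orient.
have c j : {for x, continuous (fun c : 'rV[R]_2 => c 0 j - a 0 j)}.
  apply: (@continuousB R R^o 'rV[R]_2); first exact: coord_continuous.
  exact: cst_continuous.
apply: (@continuousB R R^o 'rV[R]_2).
  apply: (@continuousM R 'rV[R]_2 (fun=> b 0 0 - a 0 0)); last exact: c.
  exact: cst_continuous.
apply: (@continuousM R 'rV[R]_2 (fun=> b 0 1 - a 0 1)); last exact: c.
exact: cst_continuous.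
Qed.

Lemma open_halfplane a b : open [set x | 0 < orient a b x].
Proof.
apply: (@open_comp _ _ (orient a b) [set r | 0 < r]); last exact: open_gt.
by move=> x _; apply: orient_continuous.
Qed.

Lemma closed_halfplane a b : closed [set x | 0 <= orient a b x].
Proof.
apply: (@closed_comp _ _ (orient a b) [set r | 0 <= r]); last exact: closed_ge.
by move=> x _; apply: orient_continuous.
Qed.

Lemma line_continuous x y : continuous (fun s : R => (1 - s) *: x + s *: y).
Proof.
move=> s; apply: (@continuousD R 'rV[R]_2 R).
  apply: (@continuousZ R 'rV[R]_2 R (fun s => 1 - s) (fun=> x)).
    by apply: (@continuousB R R^o R (cst 1) id); [exact: cst_continuous|exact: cvg_id].
  exact: cst_continuous.
apply: (@continuousZ R 'rV[R]_2 R id (fun=> y)); first exact: cvg_id.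
exact: cst_continuous.
Qed.

Lemma nbhs_towards x y B : nbhs x B ->
  exists s, [/\ 0 < s, s < 1 & B ((1 - s) *: x + s *: y)].
Proof.
move=> xB.
have : \forall s \near 0^'+, B ((1 - s) *: x + s *: y).
  apply: cvg_at_right_filter (B) _; first exact: (@line_continuous x y 0).
  by rewrite subr0 scale1r scale0r addr0.
move=> Bs; near (0 : R)^'+ => s; exists s; split.
- by near: s; apply: nbhs_right_gt.
- by near: s; apply: nbhs_right_lt.
- by near: s.
Unshelve. all: by end_near. Qed.

Lemma segment_closed_connected C : segment_closed C -> connected C.
Proof.
move=> cC; have [->|/set0P[x Cx]] := eqVneq C set0; first exact: connected0.
have -> : C = \bigcup_(y in C) segment x y.
  apply/seteqP; split=> [y Cy|y [z Cz]]; first by exists y => //; apply: segmentr.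
  exact: segment_sub.
apply: bigcup_connected; first by exists x => y _; apply: segmentl.
move=> y _; apply: connected_continuous_connected.
  exact: segment_connected.
by apply: continuous_subspaceT; apply: line_continuous.
Qed.

(** Such a [U] is both open and closed relative to [W]. *)
Lemma connected_component_open U W x : open U -> connected U -> U `<=` W ->
  closure U `&` W `<=` U -> U x -> connected_component W x = U.
Proof.
move=> oU cU UW clU Ux; apply/seteqP; split; last exact: connected_component_max.
have CW := @connected_component_sub _ W x.
have UC := connected_component_max Ux UW cU.
have <- : connected_component W x `&` U = connected_component W x.
  apply: (@component_connected _ W x); first by exists x; split=> //; apply: UC.
    by exists U.
  exists (closure U); first exact: closed_closure.
  apply/seteqP; split=> [y [Cy Uy]|y [Cy Uy]]; split=> //.
    exact: subset_closure.
  by apply: clU; split=> //; apply: CW.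
by move=> y [].
Qed.

End PlaneTopology.

(** * Convex polygons *)

Definition nxt (m i : nat) : nat := if i.+1 == m then 0%N else i.+1.

Lemma nxt_cases m i : i.+1 = m /\ nxt m i = 0%N \/ i.+1 <> m /\ nxt m i = i.+1.
Proof. by rewrite /nxt; case: eqP; [left|right]. Qed.

Lemma nxt_lt m i : (i < m)%N -> (nxt m i < m)%N.
Proof. by have := nxt_cases m i; lia. Qed.

Section Polygon.
Variables (R : realType) (m : nat) (q : nat -> 'rV[R]_2).
Hypothesis hq : ccw m q.

Definition open_polygon : set 'rV[R]_2 :=
  [set x | forall i, (i < m)%N -> 0 < orient (q i) (q (nxt m i)) x].

Definition closed_polygon : set 'rV[R]_2 :=
  [set x | forall i, (i < m)%N -> 0 <= orient (q i) (q (nxt m i)) x].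

Lemma side_gt0 i j : (i < m)%N -> (j < m)%N -> j != i -> j != nxt m i ->
  0 < orient (q i) (q (nxt m i)) (q j).
Proof.
rewrite /nxt => im jm ji; have [iE|im'] := eqVneq i.+1 m => jn.
  by rewrite orient_cyc; apply: hq; lia.
have [ij|ji'] := ltnP i j; first by apply: hq; lia.
by rewrite -orient_cyc; apply: hq; lia.
Qed.

Lemma side_ge0 i j : (i < m)%N -> (j < m)%N ->
  0 <= orient (q i) (q (nxt m i)) (q j).
Proof.
move=> im jm; have [->|ji] := eqVneq j i; first by rewrite orientl.
have [->|jn] := eqVneq j (nxt m i); first by rewrite orientr.
exact/ltW/side_gt0.
Qed.

Lemma closed_polygon_segment_closed : segment_closed closed_polygon.
Proof.
move=> x y s s0 s1 hx hy i im; exact: (halfplane_closed s0 s1 (hx i im) (hy i im)).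
Qed.

Lemma vertex_closed_polygon j : (j < m)%N -> closed_polygon (q j).
Proof. by move=> jm i im; apply: side_ge0. Qed.

Lemma open_polygon_shrink x y s : 0 < s -> s <= 1 -> closed_polygon x ->
  open_polygon y -> open_polygon ((1 - s) *: x + s *: y).
Proof.
move=> s0 s1 hx hy i im; rewrite orient_affine.
have ox := hx i im; have oy := hy i im.
by rewrite ltr_wpDl ?mulr_gt0// mulr_ge0// subr_ge0.
Qed.

Lemma open_sub_closed_polygon : open_polygon `<=` closed_polygon.
Proof. by move=> x hx i im; apply/ltW/hx. Qed.

Lemma open_polygon_segment_closed : segment_closed open_polygon.
Proof.
move=> x y s s0 s1 hx hy; have [->|sn] := eqVneq s 0.
  by rewrite subr0 scale1r scale0r addr0.
apply: open_polygon_shrink => //; first by rewrite lt_def sn.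
exact: open_sub_closed_polygon.
Qed.

Lemma open_open_polygon : open open_polygon.
Proof.
suff H k : open [set x | forall i, (i < k)%N -> 0 < orient (q i) (q (nxt m i)) x].
  exact: H.
elim: k => [|k IH].
  have -> : [set x | forall i, (i < 0)%N -> 0 < orient (q i) (q (nxt m i)) x] = setT.
    by apply/seteqP; split.
  exact: openT.
have -> : [set x | forall i, (i < k.+1)%N -> 0 < orient (q i) (q (nxt m i)) x] =
    [set x | forall i, (i < k)%N -> 0 < orient (q i) (q (nxt m i)) x] `&`
    [set x | 0 < orient (q k) (q (nxt m k)) x].
  apply/seteqP; split=> [x hx|x [hx hk] i].
    by split=> [i ik|]; apply: hx => //; lia.
  by rewrite ltnS leq_eqVlt => /orP[/eqP->//|]; apply: hx.
by apply: openI => //; apply: open_halfplane.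
Qed.

Lemma closed_closed_polygon : closed closed_polygon.
Proof.
rewrite (_ : closed_polygon = \bigcap_(i in [set i | (i < m)%N])
    [set x | 0 <= orient (q i) (q (nxt m i)) x]).
  by apply: closed_bigI => i _; apply: closed_halfplane.
by apply/seteqP; split.
Qed.

Hypothesis m3 : (3 <= m)%N.

(** The centroid of three vertices works, as each side misses one of them. *)
Lemma open_polygon_neq0 : open_polygon !=set0.
Proof.
exists ((1 - 3^-1) *: ((1 - 2^-1) *: q 0%N + 2^-1 *: q 1%N) + 3^-1 *: q 2%N).
move=> i im; rewrite !orient_affine.
have h0 : 0 <= orient (q i) (q (nxt m i)) (q 0%N) by apply: side_ge0; lia.
have h1 : 0 <= orient (q i) (q (nxt m i)) (q 1%N) by apply: side_ge0; lia.
have h2 : 0 <= orient (q i) (q (nxt m i)) (q 2%N) by apply: side_ge0; lia.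
have : [\/ 0 < orient (q i) (q (nxt m i)) (q 0%N),
          0 < orient (q i) (q (nxt m i)) (q 1%N)
        | 0 < orient (q i) (q (nxt m i)) (q 2%N)].
  have := nxt_cases m i; case: i im {h0 h1 h2} => [|[|i]] im ni.
  - by apply: Or33; apply: side_gt0; lia.
  - by apply: Or31; apply: side_gt0; lia.
  - by apply: Or32; apply: side_gt0; lia.
by case=> h; lra.
Qed.

(** A point of the closed polygon is approached along the segment joining it to
   any interior point. *)
Lemma closure_open_polygon : closure open_polygon = closed_polygon.
Proof.
apply/seteqP; split.
  rewrite [X in _ `<=` X]((closure_id closed_polygon).1 closed_closed_polygon).
  exact/closure_subset/open_sub_closed_polygon.
move=> x hx B xB; have [y hy] := open_polygon_neq0.
have [s [s0 s1 Bs]] := nbhs_towards y xB.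
by exists ((1 - s) *: x + s *: y); split=> //; apply: open_polygon_shrink => //; lra.
Qed.

(** The half-planes of the two neighbouring sides cut down the line through a
   side to that side. *)
Lemma closed_polygon_side x i : (i < m)%N -> closed_polygon x ->
  orient (q i) (q (nxt m i)) x = 0 -> segment (q i) (q (nxt m i)) x.
Proof.
move=> im hx x0.
have nm := nxt_lt im; have nnm := nxt_lt nm.
have n1 := nxt_cases m i; have n2 := nxt_cases m (nxt m i).
have ni : nxt m i != i by lia.
have nni : nxt m (nxt m i) != i by lia.
have nnn : nxt m (nxt m i) != nxt m i by lia.
have [h [hm hi]] : exists h, (h < m)%N /\ nxt m h = i.
  have [->|i0] := posnP i.
    by exists m.-1; have := nxt_cases m m.-1; lia.
  by exists i.-1; have := nxt_cases m i.-1; lia.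
have n3 := nxt_cases m h.
have hni : h != i by lia.
have hnn : h != nxt m i by lia.
have qd : q i != q (nxt m i).
  apply/eqP => e; have := side_gt0 im nnm nni nnn.
  by rewrite -e orient_cyc orientl ltxx.
have [s xE] := orient0_line qd x0; apply/segmentP; exists s; split=> //.
  have := hx _ hm; rewrite hi xE orient_affine orientr mulr0 add0r.
  rewrite pmulr_lge0// -[X in orient _ (q X)]hi; apply: side_gt0; rewrite ?hi//.
    by rewrite eq_sym.
have := hx _ nm; rewrite xE orient_affine orientl mulr0 addr0.
rewrite pmulr_lge0 ?subr_ge0//.
by apply: side_gt0 => //; rewrite eq_sym.
Qed.

Lemma boundary_open_polygon :
  boundary open_polygon =
  \bigcup_(i in [set i | (i < m)%N]) segment (q i) (q (nxt m i)).
Proof.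
rewrite /boundary closure_open_polygon.
rewrite ((interior_id open_polygon).1 open_open_polygon).
apply/seteqP; split=> [x [hx nx]|x [i /= im /segmentP[s [s0 s1 xE]]]].
  have [i [im xi]] : exists i, (i < m)%N /\ orient (q i) (q (nxt m i)) x <= 0.
    apply: contrapT => N; apply: nx => i im; rewrite ltNge; apply/negP => le.
    by apply: N; exists i.
  exists i => //; apply: closed_polygon_side => //.
  by apply/le_anti/andP; split=> //; apply: hx.
rewrite xE; split.
  apply: closed_polygon_segment_closed => //; apply: vertex_closed_polygon => //.
  exact: nxt_lt.
move=> /(_ i im); rewrite orient_affine orientl orientr !mulr0 addr0.
by rewrite ltxx.
Qed.

End Polygon.

(** * Edges of the hull *)

Section HullEdges.
Variables (R : realType) (n : nat) (q : nat -> 'rV[R]_2).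
Hypothesis hq : ccw n q.

Let H : set 'rV[R]_2 := convex_hull [set q i | i in [set i | (i < n)%N]].

Lemma hull_sub_closed_polygon : H `<=` closed_polygon n q.
Proof.
apply: hull_min; first exact: closed_polygon_segment_closed.
by move=> _ [i /= iN <-]; apply: vertex_closed_polygon.
Qed.

Lemma vertex_hull i : (i < n)%N -> H (q i).
Proof. by move=> iN; apply: sub_hull; exists i. Qed.

(** Vertices [k] and [l] on the two sides of a diagonal [ij] give a quadrangle
   [ikjl] inside the hull that contains the midpoint of the diagonal in its
   interior. *)
Lemma quad_midpoint i j k l :
  0 < orient (q i) (q k) (q j) -> 0 < orient (q i) (q j) (q l) ->
  0 < orient (q k) (q j) (q l) -> 0 < orient (q i) (q k) (q l) ->
  (i < n)%N -> (j < n)%N -> (k < n)%N -> (l < n)%N ->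
  ~ (segment (q i) (q j) `<=` boundary H).
Proof.
move=> ikj ijl kjl ikl iN jN kN lN S.
pose x := (1 - 2^-1) *: q i + 2^-1 *: q j.
have [] : boundary H x.
  by apply: S; apply/segmentP; exists 2^-1; split=> //; lra.
move=> _; apply; rewrite interiorEbigcup.
exists ([set x | 0 < orient (q i) (q k) x] `&` [set x | 0 < orient (q k) (q j) x]
  `&` ([set x | 0 < orient (q j) (q l) x] `&` [set x | 0 < orient (q l) (q i) x])).
  split; first by do !apply: openI; apply: open_halfplane.
  move=> y [[/= yik ykj] [yjl yli]]; have [yij|yij] := leP 0 (orient (q i) (q j) y).
    apply: (segment_closed_triangle _ _ _ _ ijl) => //; try exact: vertex_hull.
    - exact: hull_closed.
    - exact: ltW.
    - exact: ltW.
  apply: (segment_closed_triangle _ _ _ _ ikj) => //; try exact: vertex_hull.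
  - exact: hull_closed.
  - exact: ltW.
  - exact: ltW.
  - by rewrite orient_swap oppr_ge0 ltW.
split; split; rewrite /= /x orient_affine ?orientl ?orientr.
- by lra.
- by rewrite -orient_cyc; lra.
- by rewrite -orient_cyc; lra.
- by rewrite orient_cyc; lra.
Qed.

Lemma diagonal_not_boundary i j : (i < j)%N -> (j < n)%N -> j != i.+1 ->
  ~~ ((i == 0%N) && (j == n.-1)) -> ~ (segment (q i) (q j) `<=` boundary H).
Proof.
move=> ij jn ij1 ijn.
have [jn1|jn1] := ltnP j.+1 n.
  by apply: (@quad_midpoint i j i.+1 j.+1); try apply: hq; lia.
apply: (@quad_midpoint i j i.+1 0%N); try lia.
- by apply: hq; lia.
- by rewrite -orient_cyc; apply: hq; lia.
- by rewrite -orient_cyc; apply: hq; lia.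
- by rewrite -orient_cyc; apply: hq; lia.
Qed.

Hypothesis n3 : (3 <= n)%N.

(** The hull lies on one side of the line through the side, and that line cannot
   pass through an interior point of the hull: pushing such a point away from a
   third vertex would leave the half-plane. *)
Lemma side_sub_boundary_hull i : (i < n)%N ->
  segment (q i) (q (nxt n i)) `<=` boundary H.
Proof.
move=> iN x ix; split.
  apply: subset_closure; apply: segment_sub ix; first exact: hull_closed.
    exact: vertex_hull.
  by apply: vertex_hull; apply: nxt_lt.
move=> xH; have n1 := nxt_cases n i; have n2 := nxt_cases n (nxt n i).
have x0 : orient (q i) (q (nxt n i)) x = 0.
  by case/segmentP: ix => s [_ _ ->]; rewrite orient_affine orientl orientr; lra.
have [k0] : 0 < orient (q i) (q (nxt n i)) (q (nxt n (nxt n i))).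
  by apply: side_gt0 => //; lia.
(* The reflection in [x] of a vertex off the side, in the form used by
   [orient_affine]. *)
pose y := (1 - (-1)) *: x + (-1) *: q (nxt n (nxt n i)).
have [s [s0 s1 /hull_sub_closed_polygon/(_ _ iN)]] := nbhs_towards y xH.
rewrite orient_affine /y orient_affine x0 !mulr0 !add0r mulN1r mulrN oppr_ge0.
by rewrite pmulr_rle0// leNgt k0.
Qed.

End HullEdges.

(** * The fan of polygons at vertex 0 *)

Definition spoke (G j : nat) : bool := (j %% G == 1)%N.

(** Consecutive spokes end [G] vertices apart, so they bound, with the sides between
   them, a polygon with [G + 2] sides. The spoke to vertex 1 and, when [n - 2] is a
   multiple of [G], the one to vertex [n - 1] are themselves sides, so the relation
   then contains all sides of an [n]-gon without mentioning [n]. *)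
Definition fan (G : nat) : rel nat := [rel i j | [|| j == i.+1, i == j.+1,
  (i == 0%N) && spoke G j | (j == 0%N) && spoke G i]].

Lemma spoke0 G : spoke G 0 = false.
Proof. by rewrite /spoke mod0n. Qed.

Lemma fan_sym G : symmetric (fan G).
Proof. by move=> i j; rewrite /fan /= orbCA [X in _ || (_ || X)]orbC. Qed.

Lemma fan_irr G : irreflexive (fan G).
Proof. by move=> i; rewrite /fan /=; have := spoke0 G; case: i => [|i]; lia. Qed.

Section Noncrossing.
Variables (R : realType) (G n : nat) (q : nat -> 'rV[R]_2).
Hypothesis hq : ccw n q.

Lemma chord_sign i j k : (i < j)%N -> (j < n)%N -> (k < n)%N ->
  [\/ (k = i \/ k = j) /\ orient (q i) (q j) (q k) = 0,
      (i < k < j)%N /\ orient (q i) (q j) (q k) < 0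
    | ((k < i) || (j < k))%N /\ 0 < orient (q i) (q j) (q k)].
Proof.
move=> ij jn kn.
have [->|ki] := eqVneq k i; first by apply: Or31; rewrite orientl; split; [left|].
have [->|kj] := eqVneq k j; first by apply: Or31; rewrite orientr; split; [right|].
have [ki'|ik] := ltnP k i.
  by apply: Or33; split=> //; rewrite -orient_cyc hq.
have [jk|jk] := ltnP j k; first by apply: Or33; rewrite orbT hq.
apply: Or32; split; first lia.
by rewrite orient_flip oppr_lt0 hq//; lia.
Qed.

(** The endpoints of the second edge lie on the same closed side of the first,
   so the segments can only meet at an endpoint of the second lying on the
   line of the first. *)
Lemma fan_noncrossing i j k l x : (i < n)%N -> (j < n)%N -> (k < n)%N -> (l < n)%N ->
  fan G i j -> fan G k l -> ~ (i = k /\ j = l) -> ~ (i = l /\ j = k) ->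
  segment (q i) (q j) x -> segment (q k) (q l) x ->
  exists2 v, x = q v & (v = i \/ v = j) /\ (v = k \/ v = l).
Proof.
wlog ij : i j / (i < j)%N.
  move=> W iN jN kN lN fij fkl N1 N2 xij xkl.
  have [ij|ij|ij] := ltngtP i j; first exact: W.
    rewrite segmentC in xij; rewrite fan_sym in fij.
    have [||v -> [[->|->] hv]] := W _ _ ij jN iN kN lN fij fkl _ _ xij xkl.
    - by case=> *; apply: N2.
    - by case=> *; apply: N1.
    - by exists j => //; split=> //; right.
    - by exists i => //; split=> //; left.
  by rewrite ij fan_irr in fij.
move=> iN jN kN lN fij fkl N1 N2 /segmentP[r [r0 r1 xij]] /segmentP[s [s0 s1 xkl]].
have kl : k <> l by move=> kl; rewrite kl fan_irr in fkl.
have x0 : orient (q i) (q j) x = 0.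
  by rewrite xij orient_affine orientl orientr !mulr0 addr0.
rewrite xkl orient_affine in x0.
have K : s = 0 -> x = q k by move=> s_0; rewrite xkl s_0 subr0 scale1r scale0r addr0.
have L : s = 1 -> x = q l by move=> s_1; rewrite xkl s_1 subrr scale1r scale0r add0r.
have [[kij ok]|[kij ok]|[kij ok]] := chord_sign ij jN kN;
have [[lij ol]|[lij ol]|[lij ol]] := chord_sign ij jN lN.
- by exfalso; lia.
- exists k; last by split=> //; left.
  by apply: K; rewrite ok mulr0 add0r in x0; nra.
- exists k; last by split=> //; left.
  by apply: K; rewrite ok mulr0 add0r in x0; nra.
- exists l; last by split=> //; right.
  by apply: L; rewrite ol mulr0 addr0 in x0; nra.
- by exfalso; clear - s0 s1 x0 ok ol; nra.
- by exfalso; move: fij fkl; rewrite /fan /=; lia.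
- exists l; last by split=> //; right.
  by apply: L; rewrite ol mulr0 addr0 in x0; nra.
- by exfalso; move: fij fkl; rewrite /fan /=; lia.
- by exfalso; clear - s0 s1 x0 ok ol; nra.
Qed.

End Noncrossing.

(** The [k]-th polygon of the fan has the common vertex 0 at position 0 and the
   vertices from [k * G + 1] to [k.+1 * G + 1] at the other positions. *)
Definition sector (G k i : nat) : nat := if i == 0%N then 0%N else (k * G + i)%N.

Lemma spokeM G k : (2 <= G)%N -> spoke G (k * G + 1).
Proof. by move=> G2; rewrite /spoke modnMDl modn_small. Qed.

Lemma sector_inj G k i j : sector G k i = sector G k j -> i = j.
Proof. by rewrite /sector; case: i j => [|i] [|j] //=; lia. Qed.

Lemma sector_fan G k i : (2 <= G)%N -> (i < G.+2)%N ->
  fan G (sector G k i) (sector G k (nxt G.+2 i)).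
Proof.
move=> G2 ig; have := nxt_cases G.+2 i; have := spokeM k G2; have := spokeM k.+1 G2.
rewrite /sector /fan /=.
case: i ig => [|i] ig s1 s0 ni.
  have -> : nxt G.+2 0 = 1%N by lia.
  by rewrite /= s0 !orbT.
case: ni => [[ni ->]|[ni ->]] /=; last by lia.
have -> : (k * G + i.+1 = k.+1 * G + 1)%N by lia.
by rewrite s1 !orbT.
Qed.

Lemma spoke_outside G k j : spoke G j ->
  (j <= k * G + 1)%N \/ (k.+1 * G + 1 <= j)%N.
Proof.
move=> /eqP jG; have jE := divn_eq j G; rewrite jG in jE.
have [le|lt] := leqP (j %/ G)%N k; [left|right];
  by rewrite jE leq_add2r leq_mul2r ?le ?lt orbT.
Qed.

Lemma sign_change (R : realDomainType) (f : nat -> R) m : 0 <= f 0%N -> f m.+1 <= 0 ->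
  exists2 k, (k <= m)%N & 0 <= f k /\ f k.+1 <= 0.
Proof.
move=> f0; elim: m => [|m IH] fm; first by exists 0%N.
have [le|lt] := leP (f m.+1) 0; last by exists m.+1 => //; split=> //; apply: ltW.
by have [k km fk] := IH le; exists k => //; lia.
Qed.

Section Fan.
Variables (R : realType) (G t n : nat) (q : nat -> 'rV[R]_2).
Hypotheses (nE : n = (G.+2 + t * G)%N) (hq : ccw n q).

Lemma sector_end k : (k <= t)%N -> (k * G + G.+2 <= n)%N.
Proof. by move=> kt; rewrite nE addnC leq_add2l leq_mul2r kt orbT. Qed.

Lemma sector_lt k i : (k <= t)%N -> (i < G.+2)%N -> (sector G k i < n)%N.
Proof. by move=> /sector_end; rewrite /sector; case: i => //=; lia. Qed.

Lemma sector_ccw k : (k <= t)%N -> ccw G.+2 (fun i => q (sector G k i)).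
Proof.
move=> kt i j l ij jl lg; have := sector_end kt; move=> kn.
by apply: hq; rewrite /sector; case: i j l ij jl lg => [|i] [|j] [|l] //=; lia.
Qed.

Hypothesis G2 : (2 <= G)%N.

(** Let [lo] and [hi] be the ends of the two spokes of the [k]-th polygon. The ends
   of an edge are both at most [lo], or both at least [hi] or 0, or the edge is a
   side of the [k]-th polygon; the separating side is accordingly the spoke to
   [lo], the spoke to [hi] or the edge itself. *)
Lemma fan_outside k i j : (k <= t)%N -> (i < n)%N -> (j < n)%N -> fan G i j ->
  exists2 a, (a < G.+2)%N &
    let side x := orient (q (sector G k a)) (q (sector G k (nxt G.+2 a))) (q x) in
    side i <= 0 /\ side j <= 0.
Proof.
move=> kt iN jN.
have kn := sector_end kt.
pose lo := (k * G + 1)%N; pose hi := (k.+1 * G + 1)%N.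
have lh : (lo < hi)%N by rewrite /lo /hi; lia.
have hn : (hi < n)%N by rewrite /hi; move: kn; lia.
have low x : (x <= lo)%N -> orient (q 0%N) (q lo) (q x) <= 0.
  move=> xl; have [->|x0] := posnP x; first by rewrite orientl.
  have [->|xn] := eqVneq x lo; first by rewrite orientr.
  by rewrite orient_flip oppr_le0 ltW// hq//; lia.
have high x : (x < n)%N -> (hi <= x)%N || (x == 0%N) ->
    orient (q hi) (q 0%N) (q x) <= 0.
  move=> xN; have [->|x0 /=] := eqVneq x 0%N; first by rewrite orientr.
  rewrite orbF => hx; have [->|xn] := eqVneq x hi; first by rewrite orientl.
  by rewrite orient_swap oppr_le0 ltW// hq//; lia.
have Low : (i <= lo)%N -> (j <= lo)%N -> exists2 a, (a < G.+2)%N &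
    let side x := orient (q (sector G k a)) (q (sector G k (nxt G.+2 a))) (q x) in
    side i <= 0 /\ side j <= 0.
  move=> il jl; exists 0%N; first lia.
  have -> : nxt G.+2 0 = 1%N by have := nxt_cases G.+2 0; lia.
  by split; apply: low.
have High : (hi <= i)%N || (i == 0%N) -> (hi <= j)%N || (j == 0%N) ->
    exists2 a, (a < G.+2)%N &
    let side x := orient (q (sector G k a)) (q (sector G k (nxt G.+2 a))) (q x) in
    side i <= 0 /\ side j <= 0.
  move=> il jl; exists G.+1; first lia.
  have -> : nxt G.+2 G.+1 = 0%N by have := nxt_cases G.+2 G.+1; lia.
  have -> : sector G k G.+1 = hi.
    by rewrite /sector /hi /=; lia.
  by split; apply: high.
have Mid a : (0 < a)%N -> (a.+1 < G.+2)%N -> (i = k * G + a)%N \/ (i = k * G + a.+1)%N ->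
   (j = k * G + a)%N \/ (j = k * G + a.+1)%N -> exists2 a, (a < G.+2)%N &
    let side x := orient (q (sector G k a)) (q (sector G k (nxt G.+2 a))) (q x) in
    side i <= 0 /\ side j <= 0.
  move=> a0 ag ia ja; exists a; first lia.
  have -> : nxt G.+2 a = a.+1 by have := nxt_cases G.+2 a; lia.
  have -> : sector G k a = (k * G + a)%N by rewrite /sector; case: eqP => //; lia.
  have -> : sector G k a.+1 = (k * G + a.+1)%N by [].
  by split; [case: ia => ->|case: ja => ->]; rewrite ?orientl ?orientr.
case/or4P => [/eqP jE|/eqP iE|/andP[/eqP i0 js]|/andP[/eqP j0 is_]].
- have [jl|jl] := leqP j lo; first by apply: Low; lia.
  have [ih|ih] := leqP hi i; first by apply: High; lia.
  by apply: (Mid (i - k * G)%N); move: jl ih; rewrite /lo /hi; lia.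
- have [jl|jl] := leqP i lo; first by apply: Low; lia.
  have [ih|ih] := leqP hi j; first by apply: High; lia.
  by apply: (Mid (j - k * G)%N); move: jl ih; rewrite /lo /hi; lia.
- by case: (spoke_outside k js) => h; [apply: Low|apply: High]; lia.
- by case: (spoke_outside k is_) => h; [apply: Low|apply: High]; lia.
Qed.

Lemma fan_segment_disjoint k i j x : (k <= t)%N -> (i < n)%N -> (j < n)%N ->
  fan G i j -> segment (q i) (q j) x ->
  ~ open_polygon G.+2 (fun a => q (sector G k a)) x.
Proof.
move=> kt iN jN /(fan_outside kt iN jN)[a ag [/= hi hj]].
move=> /segmentP[s [s0 s1 ->]] /(_ a ag); rewrite orient_affine ltNge => /negP; apply.
by rewrite -oppr_ge0 opprD -!mulrN addr_ge0// mulr_ge0 ?oppr_ge0// subr_ge0.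
Qed.

(** Rotating a ray around vertex 0 over the spokes, the orientation of [x] with
   respect to the ray changes sign between the two spokes that bound the polygon
   containing [x]. *)
Lemma closed_polygon_fan x : closed_polygon n q x ->
  exists2 k, (k <= t)%N & closed_polygon G.+2 (fun a => q (sector G k a)) x.
Proof.
move=> hx; have n4 : (4 <= n)%N by lia.
have [||k kt [hl hh]] := @sign_change R (fun k => orient (q 0%N) (q (k * G + 1)%N) x) t.
- have := hx 0%N; have -> : nxt n 0 = 1%N by have := nxt_cases n 0; lia.
  by rewrite mul0n; apply; lia.
- have -> : (t.+1 * G + 1 = n.-1)%N by rewrite nE; lia.
  rewrite orient_swap oppr_le0; have := hx n.-1.
  by have -> : nxt n n.-1 = 0%N; [have := nxt_cases n n.-1; lia|apply; lia].
exists k => // a ag; have kn := sector_end kt.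
have := nxt_cases G.+2 a; rewrite /sector; case: a ag => [|a] ag.
  by move=> ?; have -> : nxt G.+2 0 = 1%N by lia.
case=> [[ga ->]|[ga ->]] /=.
  have -> : (k * G + a.+1 = k.+1 * G + 1)%N by lia.
  by rewrite orient_swap oppr_ge0.
have := hx (k * G + a.+1)%N.
have -> : nxt n (k * G + a.+1) = (k * G + a.+2)%N.
  by have := nxt_cases n (k * G + a.+1); lia.
by apply; lia.
Qed.

End Fan.

(** * A Hamiltonian cycle avoiding the fan *)

(** For [n] odd these are the multiples of 2 modulo [n]; for [n] even, the numbers
   [0, 2, n - 1, n - 3, ..., 1, 4, 6, ..., n - 2]. In both cases the cyclic
   neighbours of 0 are 2 and [n - 2]. *)
Definition zigzag (n i : nat) : nat :=
  if odd n then (if (i.*2 < n)%N then i.*2 else (i.*2 - n)%N)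
  else if (i <= 1)%N then i.*2
  else if (i.*2 <= n + 2)%N then (n + 3 - i.*2)%N else (i.*2 - n)%N.

Lemma zigzag_lt n i : (5 <= n)%N -> (i < n)%N -> (zigzag n i < n)%N.
Proof. by rewrite /zigzag => n5 iN; do !case: ifP; lia. Qed.

Lemma zigzag_inj n i j : (5 <= n)%N -> (i < n)%N -> (j < n)%N ->
  zigzag n i = zigzag n j -> i = j.
Proof.
move=> n5 iN jN; have := odd_double_half n; rewrite /zigzag.
by case: (odd n); do !case: ifP; lia.
Qed.

Lemma zigzag_step n i : (5 <= n)%N -> (i < n)%N ->
  let y := zigzag n i in let z := zigzag n (nxt n i) in
  z != y.+1 /\ y != z.+1 /\
  (y = 0%N -> z = 2 \/ z = (n - 2)%N) /\ (z = 0%N -> y = 2 \/ y = (n - 2)%N).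
Proof.
move=> n5 iN; have := odd_double_half n; have := nxt_cases n i.
move: (nxt n i) => j; rewrite /zigzag.
case: (odd n); rewrite ?add0n ?add1n => nj nh /=.
  by have [hi|hi] := ltnP i.*2 n; have [hj|hj] := ltnP j.*2 n; lia.
have [hi|hi] := leqP i 1; have [hj|hj] := leqP j 1;
have [ki|ki] := leqP i.*2 (n + 2); have [kj|kj] := leqP j.*2 (n + 2); lia.
Qed.

Lemma zigzag_not_fan G t n i : (2 <= G)%N -> n = (G.+2 + t * G)%N -> (5 <= n)%N ->
  (i < n)%N -> ~~ fan G (zigzag n i) (zigzag n (nxt n i)).
Proof.
move=> G2 nE n5 iN.
have s0 := spoke0 G.
(* 2 and [n - 2] are congruent to 2 and 0 modulo [G], never to 1. *)
have s2 : spoke G 2 = false.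
  have [->//|G3] := eqVneq G 2; by rewrite /spoke modn_small//; lia.
have sn : spoke G (n - 2) = false.
  by rewrite (_ : n - 2 = t.+1 * G)%N ?/spoke ?modnMl//; lia.
have [h1 [h2 [h3 h4]]] := zigzag_step n5 iN.
move: h1 h2 h3 h4; move: (zigzag n i) (zigzag n (nxt n i)) => y z h1 h2 h3 h4.
rewrite /fan /= (negPf h1) (negPf h2) /= negb_or !negb_and.
apply/andP; split.
  by case: eqP => //= /h3[->|->]; rewrite ?s2 ?sn.
by case: eqP => //= /h4[->|->]; rewrite ?s2 ?sn.
Qed.

(** * Placing the fan on points in convex position *)

Lemma next_nth_nxt (T : eqType) (x0 : T) (c : seq T) i : uniq c ->
  (i < size c)%N -> next c (nth x0 c i) = nth x0 c (nxt (size c) i).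
Proof.
move=> uc ic; rewrite next_nth mem_nth//.
case: c uc ic => [//|y c] uc ic; rewrite index_uniq//.
case: (nxt_cases (size (y :: c)) i) => -[iE ->] /=.
  by rewrite nth_default//; move: iE => /=; lia.
by apply: set_nth_default; move: iE ic => /=; lia.
Qed.

Section Placement.
Variables (R : realType) (n : nat) (p : 'I_n -> 'rV[R]_2) (a : 'I_n) (s : seq 'I_n).
Hypotheses (us : uniq s) (ss : size s = n).

Let q i := p (nth a s i).
Hypothesis hq : ccw n q.

Lemma placement_mem v : v \in s.
Proof.
have [|_ ->] := uniq_min_size us (fun x _ => mem_enum 'I_n x).
  by rewrite size_enum_ord ss.
by rewrite mem_enum.
Qed.

Lemma placement_index_lt v : (index v s < n)%N.
Proof. by rewrite -[X in (_ < X)%N]ss index_mem placement_mem. Qed.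

Lemma placement_index v : q (index v s) = p v.
Proof. by rewrite /q nth_index// placement_mem. Qed.

Lemma placement_index_inj v w : index v s = index w s -> v = w.
Proof. by move=> e; apply: (index_inj a _ _ e); apply: placement_mem. Qed.

Lemma placement_range : range p = [set q i | i in [set i | (i < n)%N]].
Proof.
apply/seteqP; split=> [_ [v _ <-]|_ [i /= iN <-]].
  by exists (index v s); [apply: placement_index_lt|rewrite placement_index].
by exists (nth a s i).
Qed.

Section FanAngulation.
Variables (G t : nat).
Hypotheses (G2 : (2 <= G)%N) (nE : n = (G.+2 + t * G)%N).

Definition placed_fan : rel 'I_n := [rel v w | fan G (index v s) (index w s)].

Lemma placed_fan_nth i j : (i < n)%N -> (j < n)%N ->
  placed_fan (nth a s i) (nth a s j) = fan G i j.
Proof. by move=> iN jN; rewrite /placed_fan /= !index_uniq// ss. Qed.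

Lemma drawing_placed_fan x : drawing p placed_fan x ->
  exists i j, [/\ (i < n)%N, (j < n)%N, fan G i j & segment (q i) (q j) x].
Proof.
case=> [[v _ <-]|[[v w] /= vw xvw]].
  have vn := placement_index_lt v.
  have [v1|v1] := ltnP (index v s).+1 n.
    exists (index v s), (index v s).+1; split=> //; first by rewrite /fan /= eqxx.
    by rewrite placement_index; apply: segmentl.
  exists (index v s), (index v s).-1; split=> //; first lia.
    rewrite /fan /=; lia.
  by rewrite placement_index; apply: segmentl.
exists (index v s), (index w s); split=> //; try exact: placement_index_lt.
by rewrite !placement_index.
Qed.

Lemma fan_sub_drawing i j : (i < n)%N -> (j < n)%N -> fan G i j ->
  segment (q i) (q j) `<=` drawing p placed_fan.
Proof.
move=> iN jN fij x xij; right; exists (nth a s i, nth a s j) => //=.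
by rewrite placed_fan_nth.
Qed.

Lemma placed_fan_hull : contains_hull_edges p placed_fan.
Proof.
move=> v w vw; rewrite placement_range -!placement_index => S.
have n3 : (3 <= n)%N by lia.
have vn := placement_index_lt v; have wn := placement_index_lt w.
have sn : spoke G n.-1.
  have -> : n.-1 = (t.+1 * G + 1)%N by lia.
  exact: spokeM.
have ivw : index v s != index w s.
  by apply: contra_neq vw => /placement_index_inj.
apply: contrapT => N.
have [lt|lt|e] := ltngtP (index v s) (index w s); last by rewrite e eqxx in ivw.
  apply: (diagonal_not_boundary hq lt wn _ _ S).
    by apply/eqP => e; apply: N; rewrite /placed_fan /fan /= e eqxx.
  apply/negP => /andP[/eqP e0 /eqP en]; apply: N.
  by rewrite /placed_fan /fan /= en e0 sn !orbT.
rewrite segmentC in S; apply: (diagonal_not_boundary hq lt vn _ _ S).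
  by apply/eqP => e; apply: N; rewrite /placed_fan /fan /= e eqxx orbT.
apply/negP => /andP[/eqP e0 /eqP en]; apply: N.
by rewrite /placed_fan /fan /= en e0 sn !orbT.
Qed.

Lemma placed_fan_noncrossing : noncrossing p placed_fan.
Proof.
move=> i j k l ij kl N x [xij xkl].
rewrite -!placement_index in xij xkl.
have I := placement_index_inj.
have [||v -> [h1 h2]] := fan_noncrossing hq (placement_index_lt i)
  (placement_index_lt j) (placement_index_lt k) (placement_index_lt l)
  ij kl _ _ xij xkl.
- by case=> /I e1 /I e2; apply: N; rewrite e1 e2.
- by case=> /I e1 /I e2; apply: N; rewrite e1 e2 setUC.
have [u uE] : exists u, v = index u s.
  by case: h1 => ->; [exists i|exists j].
exists u; last by rewrite uE placement_index.
by move: h1 h2; rewrite uE => h1 h2; split; [case: h1|case: h2] => /I ->;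
  [left|right|left|right].
Qed.

(** An interior face contains a point of some closed polygon of the fan; this point
   is off the drawing, so off the boundary of that polygon, and the face is the
   whole open polygon. *)
Lemma placed_fan_faces A : face p placed_fan A ->
  A `<=` interior (convex_hull (range p)) -> bounded_by_cycle p G.+2 placed_fan A.
Proof.
move=> [x xD AE] AH; have n3 : (3 <= n)%N by lia.
have g3 : (3 <= G.+2)%N by lia.
have xH : closed_polygon n q x.
  apply: (hull_sub_closed_polygon hq).
  rewrite -placement_range; apply: interior_subset; apply: AH.
  by rewrite AE; apply: connected_component_refl.
have [k kt xk] := closed_polygon_fan nE G2 xH.
have cS := sector_ccw nE hq kt.
pose P := open_polygon G.+2 (fun i => q (sector G k i)).
have PD : P `<=` ~` drawing p placed_fan.
  move=> y Py /drawing_placed_fan[i [j [iN jN fij yij]]].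
  exact: (fan_segment_disjoint nE hq G2 kt iN jN fij yij Py).
have bP := boundary_open_polygon cS g3.
have bD : boundary P `<=` drawing p placed_fan.
  rewrite /P bP => y [i /= iG]; apply: fan_sub_drawing; try exact: (sector_lt nE).
    by apply: (sector_lt nE) => //; apply: nxt_lt.
  exact: sector_fan.
have clP : closure P `&` ~` drawing p placed_fan `<=` P.
  move=> y [cy nD]; apply: contrapT => nP; apply: nD; apply: bD; split=> //.
  by move=> /interior_subset.
have AP : A = P.
  rewrite AE; apply: connected_component_open => //.
  - exact: open_open_polygon.
  - exact/segment_closed_connected/open_polygon_segment_closed.
  - apply: clP; split=> //; rewrite /P (closure_open_polygon cS g3); exact: xk.
pose c := [seq nth a s (sector G k i) | i <- iota 0 G.+2].
have sc : size c = G.+2 by rewrite size_map size_iota.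
have cn i : (i < G.+2)%N -> nth a c i = nth a s (sector G k i).
  by move=> iG; rewrite (nth_map 0%N) ?size_iota// nth_iota.
have uc : uniq c.
  rewrite map_inj_in_uniq ?iota_uniq// => i j.
  rewrite !mem_iota /= add0n => iG jG /eqP.
  rewrite nth_uniq ?ss//; try exact: (sector_lt nE).
  by move=> /eqP /sector_inj.
clearbody c.
have nc i : (i < G.+2)%N -> next c (nth a c i) = nth a c (nxt G.+2 i).
  by move=> iG; rewrite next_nth_nxt ?sc.
exists c; split=> //.
  rewrite /ucycle uc andbT; apply: cycle_from_next => // v vc.
  rewrite -(nth_index a vc); have iG : (index v c < G.+2)%N by rewrite -sc index_mem.
  have niG : (nxt G.+2 (index v c) < G.+2)%N by apply: nxt_lt.
  rewrite nc// !cn// placed_fan_nth; try exact: (sector_lt nE).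
  exact: sector_fan.
rewrite AP /P bP; apply/seteqP; split=> y [i /= iG yi].
  have niG : (nxt G.+2 i < G.+2)%N by apply: nxt_lt.
  exists (nth a c i); first by rewrite /= mem_nth// sc.
  by rewrite nc// !cn.
have iG' : (index i c < G.+2)%N by rewrite -sc index_mem.
have niG : (nxt G.+2 (index i c) < G.+2)%N by apply: nxt_lt.
exists (index i c) => //.
by rewrite /q -!cn// -nc// nth_index.
Qed.

Lemma placed_fan_angulation : angulation p G.+2 placed_fan.
Proof.
split.
- by split=> [v w|v]; rewrite /placed_fan /= ?fan_irr// fan_sym.
- exact: placed_fan_noncrossing.
- exact: placed_fan_hull.
- exact: placed_fan_faces.
Qed.

End FanAngulation.
End Placement.

(** Along a cycle [c] of [F], consecutive vertices go to consecutive values of the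
   zigzag, hence to pairs outside the fan. *)
Lemma potentially_angulable_ge5 (R : realType) (G t n : nat) (p : 'I_n -> 'rV[R]_2)
    (V : finType) (F : rel V) : (2 <= G)%N -> n = (G.+2 + t * G)%N -> (5 <= n)%N ->
  convex_position p -> cycle_graph n F -> potentially_angulable p G.+2 F.
Proof.
move=> G2 nE n5 hp [c [_ sc uc cV cF]].
have n0 : (0 < n)%N by lia.
pose a := Ordinal n0.
have [s [us ss hs]] := convex_position_ccw_from hp a.
have ci v : (index v c < n)%N by rewrite -sc index_mem.
have zi v : (zigzag n (index v c) < n)%N by apply: zigzag_lt.
pose f v := nth a s (zigzag n (index v c)).
have fi v : index (f v) s = zigzag n (index v c) by rewrite /f index_uniq// ss.
have f_inj : injective f.
  move=> v w /(congr1 (index^~ s)); rewrite !fi => /zigzag_inj e.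
  by apply: (index_inj v (cV v) (cV w)); apply: e.
exists f.
  apply: inj_card_bij => //.
  by rewrite card_ord -sc -(card_uniqP uc) max_card.
exists (placed_fan s G); first exact: (placed_fan_angulation us ss hs G2 nE).
have step v w : next c v == w ->
    ~~ fan G (zigzag n (index v c)) (zigzag n (index w c)).
  move=> /eqP <-; rewrite -{2}(nth_index v (cV v)) next_nth_nxt ?sc//.
  rewrite index_uniq ?sc//; first exact: (zigzag_not_fan G2 nE).
  by apply: nxt_lt => //; lia.
move=> i j /= ij; apply/andP; split.
  by apply: contraL ij => /eqP ->; rewrite /placed_fan /= fan_irr.
apply/existsP => -[u /existsP[v /and3P[Fuv /eqP fu /eqP fv]]].
move: ij; rewrite /placed_fan /= -fu -fv !fi; apply/negP.
by move: Fuv; rewrite cF => /orP[/step//|/step]; rewrite fan_sym.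
Qed.

(** In a convex quadrangle vertex 0 has two hull edges, so only one vertex is left
   to be its neighbour in the placed 4-cycle, which gives it two. *)
Lemma not_potentially_angulable4 (R : realType) (g n : nat) (p : 'I_n -> 'rV[R]_2)
    (V : finType) (F : rel V) : n = 4 -> convex_position p -> cycle_graph n F ->
  ~ potentially_angulable p g F.
Proof.
move=> n4 hp [c [_ sc uc cV cF]] [f [f' fK f'K] [e [_ _ he _] eF]].
have n0 : (0 < n)%N by lia.
have n3 : (3 <= n)%N by lia.
pose a := Ordinal n0.
have [s [us ss hs]] := convex_position_ccw_from hp a.
have side i : (i < n)%N -> e (nth a s i) (nth a s (nxt n i)).
  move=> iN; have ni := nxt_cases n i; have nN : (nxt n i < n)%N by apply: nxt_lt.
  apply: he; first by rewrite nth_uniq ?ss//; lia.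
  by rewrite (placement_range p a us ss); apply: side_sub_boundary_hull.
have nF u v i : (i < n)%N -> f u = nth a s i -> f v = nth a s (nxt n i) -> ~~ F u v.
  move=> iN fu fv; have /andP[_] := eF _ _ (side i iN).
  apply: contra => Fuv; apply/existsP; exists u; apply/existsP; exists v.
  by rewrite Fuv fu fv !eqxx.
pose x := f' (nth a s 0); have fx : f x = nth a s 0 by rewrite f'K.
(* [j] and [k] are the positions on the cycle after and before that of [x]. *)
pose i := index x c; have iN : (i < n)%N by rewrite -sc index_mem.
pose j := nxt n i; pose k := nxt n (nxt n j).
have [jN kN] : (j < n)%N /\ (k < n)%N by split; do !apply: nxt_lt.
have ki : nxt n k = i.
  by rewrite /k /j; have := nxt_cases n i; have := nxt_cases n (nxt n i);
     have := nxt_cases n (nxt n (nxt n i));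
     have := nxt_cases n (nxt n (nxt n (nxt n i))); lia.
have jk : j != k.
  by rewrite /k; have := nxt_cases n j; have := nxt_cases n (nxt n j); lia.
have xE : nth x c i = x by rewrite nth_index.
have Fxj : F x (nth x c j).
  by rewrite cF -{1}xE next_nth_nxt ?sc// eqxx.
have Fkx : F (nth x c k) x.
  by rewrite cF next_nth_nxt ?sc// ki xE eqxx.
have Fsym u v : F u v = F v u by rewrite !cF orbC.
have only2 v : F x v -> v != x -> index (f v) s = 2.
  move=> Fxv vx; have vN := placement_index_lt us ss (f v).
  have fv : f v = nth a s (index (f v) s).
    by rewrite nth_index// (placement_mem us ss).
  have n0' : index (f v) s != 0%N.
    apply: contra_neq vx => e0; apply: (can_inj fK).
    by rewrite fv e0 fx.
  have n1' : index (f v) s != 1%N.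
    apply/negP => /eqP e1; have := nF x v 0%N n0 fx; rewrite Fxv fv e1.
    by have -> : nxt n 0 = 1%N; [have := nxt_cases n 0; lia|move=> /(_ erefl)].
  have n3' : index (f v) s != 3.
    apply/negP => /eqP e3; have := nF v x (index (f v) s) vN fv.
    rewrite Fsym Fxv fx e3.
    by have -> : nxt n 3 = 0%N; [have := nxt_cases n 3; lia|move=> /(_ erefl)].
  lia.
have xn l : (l < n)%N -> l != i -> nth x c l != x.
  by move=> lN li; rewrite -{2}xE nth_uniq ?sc.
have ij : j != i by rewrite /j; have := nxt_cases n i; lia.
have ik : k != i by rewrite -ki; have := nxt_cases n k; lia.
have := only2 _ Fxj (xn _ jN ij); rewrite Fsym in Fkx.
rewrite -(only2 _ Fkx (xn _ kN ik)) => /(placement_index_inj a us ss)/(can_inj fK)/eqP.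
by rewrite nth_uniq ?sc// (negPf jk).
Qed.

Theorem theorem5 (R : realType) (g t n : nat) (p : 'I_n -> 'rV[R]_2)
    (V : finType) (F : rel V)
    (hg : (4 <= g)%N) (hn : n = (g + t * (g - 2))%N)
    (hp : convex_position p) (hF : cycle_graph n F) :
  potentially_angulable p g F <-> (5 <= n)%N.
Proof.
have gE : g = (g - 2).+2 by lia.
split=> [pa|n5].
  rewrite leqNgt; apply/negP => n5; apply: (not_potentially_angulable4 _ hp hF pa).
  lia.
rewrite gE; apply: (potentially_angulable_ge5 (t := t)) => //; first lia.
by rewrite -gE.
Qed.
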